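(* The map $\langle\ ,\ \rangle:\mathcal H\times\mathcal H\to\mathbb Z[\xi]$ defined by $$\Big\langle\sum_{w\in S_n}r_w\tilde T_w,\ \sum_{w\in S_n}r'_w\tilde T_w\Big\rangle=\sum_{w\in S_n}r_wr'_w\qquad(r_w,r'_w\in\mathbb Z[\xi])$$ is an inner product on $\mathcal H$, and for all $u,v,w\in S_n$ it satisfies $$\langle \tilde T_u\tilde T_v\tilde T_{u^{-1}},\tilde T_w\rangle=\langle \tilde T_v,\tilde T_{u^{-1}}\tilde T_w\tilde T_u\rangle .$$
   Context: $S_n$ is the symmetric group with simple reflections $s_i=(i\ \ i+1)$, $1\le i\le n-1$. The Iwahori--Hecke algebra $\mathcal H=\mathcal H_n$ is the associative $\mathbb Z[\xi]$-algebra ($\xi$ an indeterminate) with identity $\tilde T_1$, generated by $\tilde T_{s_1},\dots,\tilde T_{s_{n-1}}$ subject to the braid relations $\tilde T_{s_i}\tilde T_{s_j}=\tilde T_{s_j}\tilde T_{s_i}$ for $|i-j|\ge 2$, $\tilde T_{s_i}\tilde T_{s_{i+1}}\tilde T_{s_i}=\tilde T_{s_{i+1}}\tilde T_{s_i}\tilde T_{s_{i+1}}$, and $\tilde T_{s_i}^2=\tilde T_1+\xi\tilde T_{s_i}$. For a reduced expression $w=s_{i_1}\cdots s_{i_r}$ put $\tilde T_w=\tilde T_{s_{i_1}}\cdots\tilde T_{s_{i_r}}$; the $\tilde T_w$, $w\in S_n$, form a $\mathbb Z[\xi]$-basis of $\mathcal H$. Here ''inner product'' means a symmetric $\mathbb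 Z[\xi]$-bilinear form that is positive definite in the sense that, for each $h\in\mathcal H$, the polynomial $\langle h,h\rangle$ takes non-negative values at all real values of $\xi$, and $\langle h,h\rangle=0$ only if $h=0$. *)

(* Defs.v *)
From HB Require Import structures.
From mathcomp Require Import all_boot all_order all_algebra all_fingroup.
From mathcomp Require Import reals.

Set Implicit Arguments.
Unset Strict Implicit.
Unset Printing Implicit Defensive.

Import Order.TTheory GRing.Theory Num.Theory.

Local Open Scope ring_scope.

Fact simple_ltn n (i : 'I_n.-1) : (i.+1 < n)%N.
Proof. by rewrite -ltn_predRL. Qed.

(* Indices start at 0: the simple reflections are s_i = (i i+1) for i < n - 1,
   permuting {0, ..., n - 1}. *)
Definition simple_refl n (i : 'I_n.-1) : 'S_n :=
  tperm (Ordinal (ltnW (simple_ltn i))) (Ordinal (simple_ltn i)).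

Definition word_perm n (e : seq 'I_n.-1) : 'S_n :=
  (\prod_(i <- e) simple_refl i)%g.

Lemma word_permP n (w : 'S_n) : exists e : seq 'I_n.-1, word_perm e = w.
Proof.
have cat_ok (u v : 'S_n) : (exists e, word_perm e = u) ->
    (exists e, word_perm e = v) -> exists e, word_perm e = (u * v)%g.
  by move=> [e <-] [f <-]; exists (e ++ f); rewrite /word_perm big_cat.
have id_ok : exists e, word_perm e = 1%g :> 'S_n.
  by exists [::]; rewrite /word_perm big_nil.
have tp d : forall x y : 'I_n, y = (x + d)%N :> nat ->
    exists e, word_perm e = tperm x y.
  elim: d => [|d IHd] x y def_y.
    suff -> : y = x by rewrite tperm1.
    by apply: val_inj; rewrite /= def_y addn0.
  have lt_i : (x + d < n.-1)%N by rewrite ltn_predRL -addnS -def_y.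
  have lt_z : (x + d < n)%N := ltnW (simple_ltn (Ordinal lt_i)).
  have s_ok : exists e, word_perm e = simple_refl (Ordinal lt_i).
    by exists [:: Ordinal lt_i]; rewrite /word_perm big_seq1.
  have def_s : simple_refl (Ordinal lt_i) = tperm (Ordinal lt_z) y.
    by congr tperm; apply: val_inj; rewrite //= def_y addnS.
  case: d => [|d] in IHd def_y lt_i lt_z s_ok def_s *.
    suff -> : x = Ordinal lt_z by rewrite -def_s.
    by apply: val_inj; rewrite /= addn0.
  have <- : (tperm x (Ordinal lt_z) ^ tperm (Ordinal lt_z) y)%g = tperm x y.
    by rewrite tpermJ tpermL tpermD // -val_eqE /= ?def_y -{2}[val x]addn0
               eqn_add2l.
  rewrite conjgE tpermV -def_s.
  by apply: cat_ok (cat_ok _ _ (IHd _ _ _) _).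
have [ts -> _] := prod_tpermP w.
elim: ts => [|t ts IHts]; first by rewrite big_nil.
rewrite big_cons; apply: cat_ok IHts.
have [le12|/ltnW le21] := leqP t.1 t.2.
  by apply: (tp (t.2 - t.1)%N); rewrite subnKC.
by rewrite tpermC; apply: (tp (t.1 - t.2)%N); rewrite subnKC.
Qed.

Fact has_word n (w : 'S_n) :
  exists k, [exists e : k.-tuple 'I_n.-1, word_perm e == w].
Proof.
have [e def_w] := word_permP w; exists (size e).
by apply/existsP; exists (in_tuple e); apply/eqP.
Qed.

Definition perm_len n (w : 'S_n) : nat := ex_minn (has_word w).

Fact has_reduced_word n (w : 'S_n) :
  exists e : (perm_len w).-tuple 'I_n.-1, word_perm e == w.
Proof. by rewrite /perm_len; case: ex_minnP => k /existsP. Qed.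

Definition reduced_word n (w : 'S_n) : seq 'I_n.-1 :=
  xchoose (has_reduced_word w).

(* Z[xi] is {poly int}, with xi = 'X. *)
Definition hecke_relations n (A : algType {poly int}) (t : 'I_n.-1 -> A) :=
  [/\ forall i j : 'I_n.-1, (i.+2 <= j)%N || (j.+2 <= i)%N ->
        t i * t j = t j * t i,
      forall i j : 'I_n.-1, j = i.+1 :> nat ->
        t i * t j * t i = t j * t i * t j
    & forall i, t i * t i = 1 + 'X *: t i].

Definition generates_alg (I : Type) (A : algType {poly int}) (t : I -> A) :=
  forall P : A -> Prop,
    P 1 -> (forall i, P (t i)) ->
    (forall a x y, P x -> P y -> P (a *: x + y)) ->
    (forall x y, P x -> P y -> P (x * y)) ->
  forall x, P x.

(* H, with the elements T i, is the associative unital Z[xi]-algebra presented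
   by the generators T i and the Hecke relations: the T i generate H, satisfy
   the relations, and map to any other family satisfying them in any algebra.
   This determines (H, T) up to unique isomorphism. *)
Definition iwahori_hecke n (H : algType {poly int}) (T : 'I_n.-1 -> H) :=
  [/\ generates_alg T,
      hecke_relations T
    & forall (A : algType {poly int}) (t : 'I_n.-1 -> A), hecke_relations t ->
        exists f : {lrmorphism H -> A}, forall i, f (T i) = t i].

(* By the braid relations, the product does not depend on which reduced
   expression of w is chosen. *)
Definition hecke_T n (H : algType {poly int}) (T : 'I_n.-1 -> H) (w : 'S_n) : H :=
  \prod_(i <- reduced_word w) T i.

Definition inner_product (R : realType) (H : lmodType {poly int})
    (form : H -> H -> {poly int}) :=
  [/\ forall g h, form g h = form h g,
      bilinear_for *%R *%R form,
      forall h (x : R), 0 <= (map_poly intr (form h h)).[x]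
    & forall h, form h h = 0 -> h = 0].

Definition defined_by_coordinates n (H : algType {poly int})
    (T : 'I_n.-1 -> H) (form : H -> H -> {poly int}) :=
  forall r r' : 'S_n -> {poly int},
    form (\sum_w r w *: hecke_T T w) (\sum_w r' w *: hecke_T T w) =
    \sum_w r w * r' w.

(* Main.v *)
(* The length of w is its number of inversions, so s_i is a left descent of w iff
   w(i) > w(i+1); Matsumoto's theorem then follows from a case analysis on two
   descents, and the T_w span H.  They are free because the left regular
   action, written on functions on S_n, satisfies the Hecke relations, so the
   universal property of H yields coordinate functions.  In the basis T_w,
   multiplication by T_i is a symmetric matrix; hence T_u and T_(u^-1) act as
   adjoint operators for the form, and <1, gh> = <1, hg>.  The last identity is
   an instance of <1, T_u x> = <1, x T_u>. *)
Require Import Defs.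
From HB Require Import structures.
From mathcomp Require Import all_boot all_order all_algebra all_fingroup.
From mathcomp Require Import reals.
From mathcomp Require Import zify ring.

Set Implicit Arguments.
Unset Strict Implicit.
Unset Printing Implicit Defensive.

Import Order.TTheory GRing.Theory Num.Theory.

Local Open Scope ring_scope.

(** * Inversions, descents and the length function of [S_n] *)

Section Length.

Variable n : nat.
Implicit Types (i j : 'I_n.-1) (w : 'S_n) (e : seq 'I_n.-1).

Definition lpt i : 'I_n := Ordinal (ltnW (simple_ltn i)).
Definition rpt i : 'I_n := Ordinal (simple_ltn i).

(** In a product [(s * w)%g] the factor [s] acts first, so left multiplication by [simple_refl i]
    exchanges the values at two neighbouring positions; this makes the comparison below the
    condition for a left descent. *)
Definition descent i w := (w (rpt i) < w (lpt i))%N.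

Definition inversions w :=
  [set p : 'I_n * 'I_n | (p.1 < p.2)%N && (w p.2 < w p.1)%N].

Lemma simple_reflK i w : (simple_refl i * (simple_refl i * w))%g = w.
Proof. by rewrite mulgA tperm2 mul1g. Qed.

Lemma simple_refl_involutive i : involutive (simple_refl i).
Proof. exact: tpermK. Qed.

Lemma simple_mull i w : (simple_refl i * w)%g (lpt i) = w (rpt i).
Proof. by rewrite permM tpermL. Qed.

Lemma simple_mulr i w : (simple_refl i * w)%g (rpt i) = w (lpt i).
Proof. by rewrite permM tpermR. Qed.

Lemma simple_mulD i w x :
  lpt i != x -> rpt i != x -> (simple_refl i * w)%g x = w x.
Proof. by move=> ? ?; rewrite permM tpermD. Qed.

Lemma val_perm_neq w (x y : 'I_n) : x != y -> (w x != w y :> nat).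
Proof. by rewrite (inj_eq val_inj) (inj_eq perm_inj). Qed.

Lemma lpt_neq_rpt i : lpt i != rpt i.
Proof. by rewrite -val_eqE /= neq_ltn leqnn. Qed.

Lemma descent_simple i w : descent i (simple_refl i * w) = ~~ descent i w.
Proof.
rewrite /descent simple_mull simple_mulr.
by have := val_perm_neq w (lpt_neq_rpt i); lia.
Qed.

(** No position lies strictly between the two that are swapped, so theirs is the only pair whose
    order changes. *)
Lemma simple_refl_lt i (x y : 'I_n) :
  (simple_refl i x < simple_refl i y)%N =
  ((x, y) == (rpt i, lpt i)) || (x < y)%N && ((x, y) != (lpt i, rpt i)).
Proof.
rewrite !xpair_eqE -!val_eqE /simple_refl.
case: tpermP => [->|->|/eqP + /eqP +]; case: tpermP => [->|->|/eqP + /eqP +];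
  rewrite -?val_eqE /=; lia.
Qed.

(** Applying [simple_refl i] to both entries of a pair carries the inversions of [simple_refl i * w]
    onto those of [w] together with [(rpt i, lpt i)], the image of the one new inversion. *)
Lemma card_inversions_simple i w :
  ~~ descent i w -> #|inversions (simple_refl i * w)| = #|inversions w|.+1.
Proof.
move=> asc; have w_lr := val_perm_neq w (lpt_neq_rpt i).
have rl_notin : (rpt i, lpt i) \notin inversions w by rewrite inE /=; lia.
have -> : #|inversions w|.+1 = #|(rpt i, lpt i) |: inversions w|.
  by rewrite cardsU1 rl_notin.
pose s2 (p : 'I_n * 'I_n) := (simple_refl i p.1, simple_refl i p.2).
have s2K : involutive s2 by case=> x y; rewrite /s2 /= !simple_refl_involutive.
rewrite -(card_imset _ (inv_inj s2K)); apply: eq_card => -[x y].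
rewrite -[(x, y)]s2K; case: (s2 (x, y)) => {}x {}y.
rewrite (mem_imset _ _ (inv_inj s2K)) in_setU1 !inE.
have -> : (s2 (x, y) == (rpt i, lpt i)) = ((x, y) == (lpt i, rpt i)).
  by rewrite -(inj_eq (inv_inj s2K)) s2K /s2 /= tpermL tpermR.
rewrite /s2 /= !permM simple_refl_lt.
rewrite /descent /= in asc w_lr *.
case: eqVneq => [[-> ->]|_] /=; first by rewrite tpermL tpermR -/(lpt i) -/(rpt i) ?ltnSn; lia.
case: eqVneq => [[-> ->]|_] /=; last by rewrite andbT.
by rewrite tpermL tpermR -/(lpt i) -/(rpt i) ?ltnSn; lia.
Qed.

Lemma word_perm_cons i e :
  word_perm (i :: e) = (simple_refl i * word_perm e)%g.
Proof. by rewrite /word_perm big_cons. Qed.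

Lemma word_perm_rev e : word_perm (rev e) = (word_perm e)^-1%g.
Proof.
elim: e => [|i e IHe]; first by rewrite /word_perm big_nil invg1.
rewrite word_perm_cons invMg tpermV -IHe rev_cons -cats1.
by rewrite /word_perm big_cat big_seq1.
Qed.

Lemma perm_len_le e : (perm_len (word_perm e) <= size e)%N.
Proof.
rewrite /perm_len; case: ex_minnP => k _; apply.
by apply/existsP; exists (in_tuple e).
Qed.

Lemma reduced_wordK w : word_perm (reduced_word w) = w.
Proof. exact/eqP/(xchooseP (has_reduced_word w)). Qed.

Lemma size_reduced_word w : size (reduced_word w) = perm_len w.
Proof. exact: size_tuple. Qed.

Lemma card_inversions_le e : (#|inversions (word_perm e)| <= size e)%N.
Proof.
elim: e => [|i e IHe].
  rewrite /word_perm big_nil leqn0 cards_eq0; apply/eqP/setP => p.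
  by rewrite !inE !perm1; case: ltngtP.
rewrite word_perm_cons /=; have [d|a] := boolP (descent i (word_perm e)).
  have := @card_inversions_simple i (simple_refl i * word_perm e).
  rewrite descent_simple d simple_reflK => /(_ isT) eq_inv.
  by rewrite (leq_trans _ (leqW IHe)) // eq_inv.
by rewrite card_inversions_simple.
Qed.

(** Such a [w] is increasing, so [x <= w x] by induction on [x]; since [w] permutes the positions,
    both sides have the same sum, which forces equality in each term. *)
Lemma no_descent_id w : (forall i, ~~ descent i w) -> w = 1%g.
Proof.
move=> asc.
have wge k : forall x : 'I_n, x = k :> nat -> (x <= w x)%N.
  elim: k => [x -> //|k IHk x xk].
  have lt_k : (k < n.-1)%N by have := ltn_ord x; lia.
  have := IHk (lpt (Ordinal lt_k)) erefl.
  have -> : x = rpt (Ordinal lt_k) by apply: val_inj.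
  have := asc (Ordinal lt_k).
  have := val_perm_neq w (lpt_neq_rpt (Ordinal lt_k)).
  by rewrite /descent /=; lia.
have le_w : (\sum_(x < n) x <= \sum_(x < n) w x
    ?= iff [forall x : 'I_n, x == w x :> nat])%N.
  by apply: leqif_sum => x _; split=> //; exact: wge erefl.
have /forallP eq_w : [forall x : 'I_n, x == w x :> nat].
  by rewrite -le_w.2 [X in X == _](reindex_inj (@perm_inj _ w)).
by apply/permP => x; rewrite perm1; apply/val_inj/esym/eqP/eq_w.
Qed.

(** A letter adds at most one inversion, which bounds the length from below. Conversely, removing
    left descents one at a time sorts [w] and yields a word with exactly one letter per
    inversion. *)
Lemma perm_len_inversions w : perm_len w = #|inversions w|.
Proof.
apply/eqP; rewrite eqn_leq; apply/andP; split; last first.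
  by rewrite -size_reduced_word -{1}[w]reduced_wordK card_inversions_le.
suff [e <- <-] : exists2 e, word_perm e = w & size e = #|inversions w|.
  exact: perm_len_le.
move: {2}#|_| (erefl #|inversions w|) => k.
elim: k w => [|k IHk] w inv_w.
  exists [::]; last by rewrite inv_w.
  rewrite /word_perm big_nil; apply/esym/no_descent_id => i; apply/negP => d.
  have : (lpt i, rpt i) \in inversions w by rewrite inE ltnSn.
  by rewrite (cards0_eq inv_w) inE.
have /existsP[i d] : [exists i, descent i w].
  apply: contraT => /existsPn/no_descent_id w1.
  by move: (card_inversions_le [::]); rewrite /word_perm big_nil -w1 inv_w.
have := @card_inversions_simple i (simple_refl i * w).
rewrite descent_simple d simple_reflK inv_w => /(_ isT)[inv_sw].
have [e def_e size_e] := IHk _ (esym inv_sw).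
by exists (i :: e); rewrite ?word_perm_cons ?def_e ?simple_reflK // inv_sw -size_e.
Qed.

Lemma perm_len_asc i w :
  ~~ descent i w -> perm_len (simple_refl i * w) = (perm_len w).+1.
Proof. by rewrite !perm_len_inversions; apply: card_inversions_simple. Qed.

Lemma perm_len_desc i w :
  descent i w -> perm_len w = (perm_len (simple_refl i * w)).+1.
Proof.
move=> d; rewrite -{1}[w](simple_reflK i) perm_len_asc //.
by rewrite descent_simple d.
Qed.

(** * Reduced words *)

Definition reduced e := size e == perm_len (word_perm e).

Lemma word_perm_nil : word_perm [::] = 1%g :> 'S_n.
Proof. by rewrite /word_perm big_nil. Qed.

Lemma perm_len1 : perm_len (1%g : 'S_n) = 0%N.
Proof. by apply/eqP; rewrite -leqn0 -word_perm_nil; apply: perm_len_le. Qed.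

Lemma reduced_nil : reduced [::].
Proof. by rewrite /reduced word_perm_nil perm_len1. Qed.

Lemma reduced_id e : reduced e -> word_perm e = 1%g -> e = [::].
Proof. by rewrite /reduced => + w1; rewrite w1 perm_len1 => /nilP. Qed.

Lemma reduced_reduced_word w : reduced (reduced_word w).
Proof. by rewrite /reduced size_reduced_word reduced_wordK. Qed.

Lemma reduced_cons i e :
  reduced (i :: e) = reduced e && ~~ descent i (word_perm e).
Proof.
rewrite /reduced /= word_perm_cons.
have le_e := perm_len_le e; have [d|a] := boolP (descent i _).
  by have := perm_len_desc d; lia.
by rewrite (perm_len_asc a) andbT eqSS.
Qed.

Lemma perm_lenV w : perm_len w^-1%g = perm_len w.
Proof.
have leV (v : 'S_n) : (perm_len v^-1%g <= perm_len v)%N.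
  rewrite -(size_reduced_word v) -size_rev -{1}[v]reduced_wordK.
  by rewrite -word_perm_rev perm_len_le.
by apply/eqP; rewrite eqn_leq leV -{1}[w]invgK leV.
Qed.

Lemma reduced_rev e : reduced e -> reduced (rev e).
Proof. by rewrite /reduced size_rev word_perm_rev perm_lenV. Qed.

(** * Commutation and braid relations in [S_n], and descents under them *)

Lemma simple_refl_far i j w : (i.+2 <= j)%N || (j.+2 <= i)%N ->
  (simple_refl i * (simple_refl j * w) = simple_refl j * (simple_refl i * w))%g.
Proof.
move=> far; rewrite !mulgA; congr (_ * _)%g; apply/commgP/conjg_fixP.
by rewrite {1}/simple_refl tpermJ !tpermD // -val_eqE /=; lia.
Qed.

Lemma descent_far i j w : (i.+2 <= j)%N || (j.+2 <= i)%N ->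
  descent i (simple_refl j * w) = descent i w.
Proof.
by move=> far; rewrite /descent !simple_mulD // -val_eqE /=; lia.
Qed.

Section Adjacent.

Variables (i j : 'I_n.-1) (adj : j = i.+1 :> nat).

Lemma rpt_adj : rpt i = lpt j.
Proof. exact: val_inj. Qed.

Lemma simple_mul_lpt_adj w : (simple_refl j * w)%g (lpt i) = w (lpt i).
Proof. by apply: simple_mulD; rewrite -val_eqE /=; lia. Qed.

Lemma simple_mul_rpt_adj w : (simple_refl i * w)%g (rpt j) = w (rpt j).
Proof. by apply: simple_mulD; rewrite -val_eqE /=; lia. Qed.

(** Both triple products are conjugates of a simple reflection, equal to the transposition of
    [lpt i] and [rpt j]. *)
Lemma simple_refl_braid w :
  (simple_refl i * (simple_refl j * (simple_refl i * w)) =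
   simple_refl j * (simple_refl i * (simple_refl j * w)))%g.
Proof.
rewrite !mulgA; congr (_ * _)%g.
have def_J k l : (simple_refl k * simple_refl l * simple_refl k =
                  simple_refl l ^ simple_refl k)%g.
  by rewrite conjgE tpermV mulgA.
rewrite !def_J {1}[in LHS]/simple_refl {1}[in RHS]/simple_refl !tpermJ.
rewrite -/(lpt i) -/(lpt j) -/(rpt i) -/(rpt j) rpt_adj tpermL -rpt_adj tpermR.
by rewrite !tpermD // -val_eqE /=; lia.
Qed.

(** In each equation both sides compare the same two among the values of [w] at [lpt i], [lpt j] and
    [rpt j]. *)
Lemma descent_adj w :
  [/\ descent i (simple_refl j * (simple_refl i * w)) = descent j w,
      descent j (simple_refl i * (simple_refl j * w)) = descent i w
    & descent j (simple_refl i * w) = descent i (simple_refl j * w)].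
Proof.
have mulr_adj v : (simple_refl i * v)%g (lpt j) = v (lpt i).
  by rewrite -rpt_adj simple_mulr.
have mull_adj v : (simple_refl i * v)%g (lpt i) = v (lpt j).
  by rewrite -rpt_adj simple_mull.
by rewrite /descent !rpt_adj; split; rewrite !(mulr_adj, mull_adj,
  simple_mul_lpt_adj, simple_mul_rpt_adj, simple_mull, simple_mulr).
Qed.

(** The left side compares the outer two of three consecutive values; when both neighbouring
    comparisons go the same way, transitivity decides it. *)
Lemma descent_adj_trans w : descent i w = descent j w ->
  descent i (simple_refl j * w) = descent i w.
Proof.
rewrite /descent rpt_adj simple_mul_lpt_adj simple_mull.
have := val_perm_neq w (lpt_neq_rpt i); rewrite rpt_adj => w_i.
have := val_perm_neq w (lpt_neq_rpt j) => w_j.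
by lia.
Qed.

End Adjacent.

End Length.

(** * Matsumoto's theorem for families satisfying the Hecke relations *)

Section Matsumoto.

Variables (n : nat) (A : algType {poly int}) (t : 'I_n.-1 -> A).
Hypothesis t_hecke : hecke_relations t.

Theorem matsumoto (e f : seq 'I_n.-1) :
  reduced e -> reduced f -> word_perm e = word_perm f ->
  \prod_(i <- e) t i = \prod_(i <- f) t i.
Proof.
have [t_comm t_braid _] := t_hecke.
move: {2}(size e) (leqnn (size e)) => m; elim: m e f => [|m IHm] e f.
  rewrite leqn0 size_eq0 => /eqP-> _ red_f def_w.
  by rewrite (reduced_id red_f) // -def_w word_perm_nil.
case: e => [|i e] size_e red_e red_f def_w.
  by rewrite (reduced_id red_f) // -def_w word_perm_nil.
case: f => [|j f] in red_f def_w *.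
  by move: (reduced_id red_e); rewrite def_w word_perm_nil => /(_ erefl).
have size_f : (size f <= m)%N.
  by move: red_e red_f; rewrite /reduced def_w => /eqP<- /eqP[->].
rewrite /= ltnS in size_e; rewrite !word_perm_cons in def_w.
move: red_e red_f; rewrite !reduced_cons => /andP[red_e asc_e] /andP[red_f asc_f].
rewrite !big_cons.
have [eq_ij|neq_ij] := eqVneq i j.
  by rewrite eq_ij (IHm e f) //; move: def_w; rewrite eq_ij => /mulgI.
wlog lt_ij: i j e f size_e size_f red_e red_f asc_e asc_f def_w neq_ij / (i < j)%N.
  move=> WH; have [lt_ij|le_ji] := ltnP i j; first exact: WH.
  by apply/esym/WH; rewrite 1?eq_sym // ltn_neqAle le_ji val_eqE eq_sym neq_ij.
set w := (simple_refl i * word_perm e)%g in def_w.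
have def_e : word_perm e = (simple_refl i * w)%g by rewrite simple_reflK.
have def_f : word_perm f = (simple_refl j * w)%g by rewrite def_w simple_reflK.
(* With two distinct descents, [w] begins with the longest element of the subgroup generated by
   [simple_refl i] and [simple_refl j]; below, [g] spells what remains. *)
have d_i : descent i w by rewrite descent_simple.
have d_j : descent j w by rewrite def_w descent_simple.
have [far|] := leqP i.+2 j.
  (* By induction [e] is exchanged for [j :: g] and [f] for [i :: g]; the two products then differ
     by one commutation. *)
  pose g := reduced_word (simple_refl j * (simple_refl i * w))%g.
  have def_g : word_perm g = (simple_refl j * (simple_refl i * w))%g.
    exact: reduced_wordK.
  have far' : (i.+2 <= j)%N || (j.+2 <= i)%N by rewrite far.
  have far'' : (j.+2 <= i)%N || (i.+2 <= j)%N by rewrite far orbT.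
  rewrite (IHm e (j :: g)) //; first last.
  - by rewrite word_perm_cons def_g simple_reflK.
  - rewrite reduced_cons reduced_reduced_word def_g descent_simple negbK.
    by rewrite descent_far.
  rewrite (IHm f (i :: g)) //; first last.
  - by rewrite word_perm_cons def_g -simple_refl_far // simple_reflK.
  - rewrite reduced_cons reduced_reduced_word def_g -simple_refl_far //.
    by rewrite descent_simple negbK descent_far.
  by rewrite !big_cons !mulrA t_comm.
move=> le_ji; have adj : j = i.+1 :> nat by lia.
have [eq1 eq2 eq3] := descent_adj adj w.
have eq4 : descent i (simple_refl j * w).
  by rewrite (descent_adj_trans adj) ?d_i ?d_j.
(* Here [e] becomes [[:: j, i & g]] and [f] becomes [[:: i, j & g]], so that a single braid relation
   finishes. *)
pose g := reduced_word (simple_refl i * (simple_refl j * (simple_refl i * w)))%g.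
have def_g : word_perm g =
    (simple_refl i * (simple_refl j * (simple_refl i * w)))%g.
  exact: reduced_wordK.
rewrite (IHm e [:: j, i & g]) //; first last.
- by rewrite !word_perm_cons def_g !simple_reflK.
- rewrite !reduced_cons reduced_reduced_word word_perm_cons def_g simple_reflK.
  by rewrite !descent_simple !negbK eq1 d_j eq3.
rewrite (IHm f [:: i, j & g]) //; first last.
- by rewrite !word_perm_cons def_g (simple_refl_braid adj) !simple_reflK.
- rewrite !reduced_cons reduced_reduced_word word_perm_cons def_g.
  rewrite (simple_refl_braid adj) simple_reflK.
  by rewrite !descent_simple !negbK eq2 d_i.
by rewrite !big_cons !mulrA t_braid.
Qed.

End Matsumoto.

(** * Multiplication by a generator, and the span of the [T_w] *)

Section Spanning.

Variables (n : nat) (H : algType {poly int}) (T : 'I_n.-1 -> H).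
Hypothesis T_hecke : hecke_relations T.

Local Notation TT := (hecke_T T).

Lemma hecke_T_word e : reduced e -> \prod_(i <- e) T i = TT (word_perm e).
Proof.
move=> red_e; apply: matsumoto => //; first exact: reduced_reduced_word.
by rewrite reduced_wordK.
Qed.

Lemma hecke_T1 : TT 1%g = 1.
Proof.
by have := hecke_T_word (reduced_nil n); rewrite word_perm_nil big_nil.
Qed.

Lemma hecke_T_asc i w :
  ~~ descent i w -> TT (simple_refl i * w)%g = T i * TT w.
Proof.
move=> asc; have red : reduced (i :: reduced_word w).
  by rewrite reduced_cons reduced_reduced_word reduced_wordK.
have := hecke_T_word red.
by rewrite big_cons word_perm_cons reduced_wordK => <-.
Qed.

(** At a descent, [TT w] factors as [T i * TT (simple_refl i * w)], and the quadratic relation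
    applies to [T i * T i]. *)
Lemma mul_T_hecke_T i w :
  T i * TT w =
  TT (simple_refl i * w)%g + (if descent i w then 'X else 0) *: TT w.
Proof.
have [_ _ T_sqr] := T_hecke.
case: ifP => [d|/negbT a]; last by rewrite hecke_T_asc // scale0r addr0.
have -> : TT w = T i * TT (simple_refl i * w)%g.
  by rewrite -hecke_T_asc ?descent_simple ?d // simple_reflK.
by rewrite mulrA T_sqr mulrDl mul1r scalerAl.
Qed.

Definition in_hecke_span h := exists r, h = \sum_w r w *: TT w.

Lemma in_hecke_spanP a x y :
  in_hecke_span x -> in_hecke_span y -> in_hecke_span (a *: x + y).
Proof.
case=> r -> [s ->]; exists (fun w => a * r w + s w).
rewrite scaler_sumr -big_split /=.
by apply: eq_bigr => w _; rewrite scalerDl scalerA.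
Qed.

Lemma in_hecke_span_T w : in_hecke_span (TT w).
Proof.
exists (fun v => (v == w)%:R); rewrite (bigD1 w) //= eqxx scale1r.
by rewrite big1 ?addr0 // => v /negPf->; rewrite scale0r.
Qed.

Lemma in_hecke_span0 : in_hecke_span 0.
Proof. by exists (fun=> 0); rewrite big1 // => w _; rewrite scale0r. Qed.

(** The elements whose left multiplication preserves the span form a subalgebra containing every
    [T i], hence all of [H]; applying this to [1], which is [TT 1], gives the claim. *)
Lemma generates_hecke_span : generates_alg T -> forall h, in_hecke_span h.
Proof.
move=> T_gen h.
suff: forall g, in_hecke_span g -> in_hecke_span (h * g).
  by move/(_ 1); rewrite mulr1 -{1}hecke_T1; apply; apply: in_hecke_span_T.
elim/T_gen: h => [|i|a x y IHx IHy|x y IHx IHy] g g_in.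
- by rewrite mul1r.
- case: g_in => r ->; rewrite mulr_sumr.
  apply: big_ind => [|x y x_in y_in|w _]; first exact: in_hecke_span0.
    by rewrite -[x]scale1r; apply: in_hecke_spanP.
  rewrite -scalerAr -[_ *: _]addr0; apply: in_hecke_spanP in_hecke_span0.
  rewrite mul_T_hecke_T addrC; apply: in_hecke_spanP; exact: in_hecke_span_T.
- by rewrite mulrDl -scalerAl; apply: in_hecke_spanP; [apply: IHx|apply: IHy].
- by rewrite -mulrA; apply/IHx/IHy.
Qed.

End Spanning.

(** * The left regular representation by matrices indexed by [S_n] *)

Section RegularRepresentation.

Variable n : nat.
Implicit Types (i j : 'I_n.-1) (w : 'S_n).

Local Notation N := #|{perm 'I_n}|.-1.

(** Writing the group order as a successor makes the square matrices of this size an algebra to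
    which [hecke_relations] applies. *)
Fact card_permS : #|{perm 'I_n}| = N.+1.
Proof. by rewrite prednK //; apply/card_gt0P; exists 1%g. Qed.

Definition perm_idx w : 'I_N.+1 := cast_ord card_permS (enum_rank w).
Definition idx_perm (a : 'I_N.+1) : 'S_n :=
  enum_val (cast_ord (esym card_permS) a).

Lemma perm_idxK : cancel perm_idx idx_perm.
Proof. by move=> w; rewrite /idx_perm cast_ordK enum_rankK. Qed.

Lemma idx_permK : cancel idx_perm perm_idx.
Proof. by move=> a; rewrite /perm_idx enum_valK cast_ordKV. Qed.

Definition descent_coef i w : {poly int} := if descent i w then 'X else 0.

(* As [w |-> s_i w] is an involution, the matrix of left multiplication by
   [T_i] in the basis [T_w] is symmetric, so it also acts on coordinates. *)
Definition regular_mx i : 'M[{poly int}]_N.+1 :=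
  \matrix_(a, b) ((b == perm_idx (simple_refl i * idx_perm a)%g)%:R
                  + descent_coef i (idx_perm a) * (b == a)%:R).

Lemma sum_eq_mul (I : finType) (x : I) (F : I -> {poly int}) :
  \sum_y (y == x)%:R * F y = F x.
Proof.
rewrite (bigD1 x) //= eqxx mul1r big1 ?addr0 // => y /negPf->.
by rewrite mul0r.
Qed.

Lemma regular_mx_mul i B w c :
  (regular_mx i * B) (perm_idx w) c =
  B (perm_idx (simple_refl i * w)%g) c + descent_coef i w * B (perm_idx w) c.
Proof.
rewrite mxE; under eq_bigr => b _ do rewrite mxE perm_idxK mulrDl -mulrA.
by rewrite big_split -mulr_sumr !sum_eq_mul.
Qed.

Lemma regular_mx_hecke : hecke_relations regular_mx.
Proof.
split=> [i j far|i j adj|i].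
(* The extra factor [1] puts every [regular_mx] to the left of some matrix, so [regular_mx_mul]
   expands all of them. *)
- rewrite -[LHS]mulr1 -[RHS]mulr1 -!mulrA; apply/matrixP => a c.
  rewrite -[a]idx_permK; set w := idx_perm a; rewrite !regular_mx_mul.
  have far' : (j.+2 <= i)%N || (i.+2 <= j)%N by rewrite orbC.
  rewrite /descent_coef (descent_far w far) (descent_far w far').
  rewrite (simple_refl_far w far); ring.
- rewrite -[LHS]mulr1 -[RHS]mulr1 -!mulrA; apply/matrixP => a c.
  rewrite -[a]idx_permK; set w := idx_perm a; rewrite !regular_mx_mul.
  have [eq1 eq2 eq3] := descent_adj adj w.
  have := @descent_adj_trans _ _ _ adj w.
  rewrite /descent_coef !simple_reflK !descent_simple eq1 eq2 eq3.
  rewrite (simple_refl_braid adj w).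
  (* If the two descents agree, transitivity fixes the third comparison; if not, the identity holds
     for either value of it. *)
  by case: (descent i w); case: (descent j w);
    [move/(_ erefl) -> | move=> _ | move=> _ | move/(_ erefl) ->];
    rewrite /=; try (by ring); case: ifP => _; ring.
- rewrite -[LHS]mulr1 -mulrA -[X in _ = _ + _ *: X]mulr1.
  apply/matrixP => a c; rewrite -[a]idx_permK; set w := idx_perm a.
  rewrite [in RHS]mxE [X in _ = _ + X]mxE !regular_mx_mul /descent_coef.
  rewrite simple_reflK descent_simple.
  by case: (descent i w) => /=; ring.
Qed.

End RegularRepresentation.

(** * Coordinate functions dual to the [T_w] *)

Section Coordinates.

Variables (n : nat) (H : algType {poly int}) (T : 'I_n.-1 -> H).
Hypothesis HT : iwahori_hecke T.

Local Notation TT := (hecke_T T).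

(** The universal property yields the regular representation [f]; the coordinates of [h] are the
    entries of [f h] in the column of the identity, that is, [h] acting on the delta function at
    [1]. *)
Lemma hecke_coordinates :
  exists c : 'S_n -> H -> {poly int},
  [/\ forall w a g h, c w (a *: g + h) = a * c w g + c w h,
      forall i w h, c w (T i * h) =
        c (simple_refl i * w)%g h + descent_coef i w * c w h
    & forall v w, c w (TT v) = (w == v)%:R].
Proof.
have [_ _ /(_ _ _ (regular_mx_hecke n))[f f_T]] := HT.
pose c w h := f h (perm_idx w) (perm_idx 1%g).
have c_mul i w h : c w (T i * h) =
    c (simple_refl i * w)%g h + descent_coef i w * c w h.
  by rewrite /c rmorphM /= f_T regular_mx_mul.
exists c; split=> // [w a g h|v w]; first by rewrite /c linearP !mxE.
have := reduced_reduced_word v; rewrite /hecke_T -{3}[v]reduced_wordK.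
elim: (reduced_word v) w => [|i e IHe] w.
  rewrite !big_nil /c rmorph1 mxE word_perm_nil.
  by rewrite (can_eq (@perm_idxK n)).
rewrite big_cons word_perm_cons reduced_cons => /andP[red_e asc].
rewrite c_mul !IHe // (can2_eq (simple_reflK i) (simple_reflK i)).
(* The term with [descent_coef] could survive only at [w = word_perm e], where reducedness of
   [i :: e] rules out a descent. *)
case: (w =P word_perm e) => [->|_]; last by rewrite mulr0 addr0.
by rewrite /descent_coef (negPf asc) mul0r addr0.
Qed.

End Coordinates.

(** * The inner product: definiteness, adjoints and trace *)

Lemma sum_sqr_poly_eq0 (I : finType) (p : I -> {poly int}) :
  \sum_i p i * p i = 0 -> forall i, p i = 0.
Proof.
move=> sum0 i; apply/eqP; apply: contraT => nz_p.
(* At each integer the values are squares summing to zero, so each vanishes; [size (p i)] distinct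
   roots are one more than a nonzero [p i] can have. *)
have root_p (x : int) : root (p i) x.
  have ge0 j : true -> 0 <= (p j * p j).[x].
    by rewrite hornerM -expr2 sqr_ge0.
  have := congr1 (horner^~ x) sum0; rewrite horner0 horner_sum.
  by move/(psumr_eq0P ge0) => eq0; rewrite /root -sqrf_eq0 expr2 -hornerM eq0.
pose s := [seq k%:Z | k <- iota 0 (size (p i))].
have := @max_poly_roots _ (p i) s nz_p; rewrite size_map size_iota ltnn; apply.
  by apply/allP => x _.
by rewrite map_inj_uniq ?iota_uniq // => x y [].
Qed.

Theorem proposition5p1 (R : realType) (n : nat) (H : algType {poly int})
    (T : 'I_n.-1 -> H) (HT : iwahori_hecke T) :
  exists form : H -> H -> {poly int},
    [/\ defined_by_coordinates T form,
        forall form', defined_by_coordinates T form' -> form' =2 form,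
        inner_product R form
      & forall u v w : 'S_n,
          form (hecke_T T u * hecke_T T v * hecke_T T u^-1%g) (hecke_T T w) =
          form (hecke_T T v) (hecke_T T u^-1%g * hecke_T T w * hecke_T T u)].
Proof.
have [T_gen T_hecke _] := HT.
have [c [c_lin c_mul c_T]] := hecke_coordinates HT.
have spanned := generates_hecke_span T_hecke T_gen.
have c0 w : c w 0 = 0.
  by have := c_lin w (-1) 0 0; rewrite scaler0 addr0 mulN1r addNr.
have cD w g h : c w (g + h) = c w g + c w h.
  by rewrite -[g]scale1r c_lin mul1r scale1r.
have cZ w a h : c w (a *: h) = a * c w h.
  by rewrite -[a *: h]addr0 c_lin c0 addr0.
have c_sum r v : c v (\sum_w r w *: hecke_T T w) = r v.
  rewrite (big_morph _ (cD v) (c0 v)) -[RHS](sum_eq_mul v r).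
  by apply: eq_bigr => w _; rewrite cZ c_T mulrC eq_sym.
pose form g h := \sum_w c w g * c w h.
have formC g h : form g h = form h g.
  by apply: eq_bigr => w _; rewrite mulrC.
have form_linr g a x y : form g (a *: x + y) = a * form g x + form g y.
  rewrite mulr_sumr -big_split; apply: eq_bigr => w _ /=.
  by rewrite c_lin; ring.
have form_coord : defined_by_coordinates T form.
  by move=> r r'; apply: eq_bigr => w _; rewrite !c_sum.
have form_T u v : form (hecke_T T u) (hecke_T T v) = (u == v)%:R.
  rewrite -[RHS](sum_eq_mul u (fun w => (w == v)%:R)).
  by apply: eq_bigr => w _; rewrite !c_T.
have form_mul1 i g h : form (T i * g) h = form g (T i * h).
  rewrite /form; under eq_bigr => w _ do rewrite c_mul mulrDl.
  under [RHS]eq_bigr => w _ do rewrite c_mul mulrDr.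
  rewrite !big_split; congr (_ + _); last first.
    by apply: eq_bigr => w _; rewrite mulrCA mulrA.
  (* Reindexing by the involution [w -> simple_refl i * w] moves the shift from one argument to the
     other. *)
  rewrite (reindex_inj (mulgI (simple_refl i))) /=.
  by apply: eq_bigr => w _; rewrite simple_reflK.
have form_mul u g h : form (hecke_T T u * g) h = form g (hecke_T T u^-1%g * h).
  have red_u := reduced_reduced_word u.
  (* Reversing a reduced word of [u] gives one of [u^-1], so the self-adjoint factors [T i] can be
     moved across one by one. *)
  rewrite -{2}[u]reduced_wordK -word_perm_rev -hecke_T_word ?reduced_rev //.
  rewrite /hecke_T; elim: (reduced_word u) g h => [|i e IHe] g h.
    by rewrite !big_nil !mul1r.
  rewrite big_cons -mulrA form_mul1 IHe rev_cons -cats1 big_cat big_seq1.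
  by rewrite mulrA.
have form_hecke_T u h : form (hecke_T T u) h = form 1 (hecke_T T u^-1%g * h).
  by rewrite -form_mul mulr1.
(* [form 1] is a trace because [form 1 (T_u * T_v)] is 1 if [v = u^-1] and 0
   otherwise; this takes care of the factors on the right. *)
have form_trace g h : form 1 (g * h) = form 1 (h * g).
  have form1_sum k (F : 'S_n -> H) r :
      form k (\sum_w r w *: F w) = \sum_w r w * form k (F w).
    apply: (big_ind2 (fun x y => form k x = y)) => [|x1 y1 x2 y2 <- <-|w _].
    - by rewrite /form big1 // => w _; rewrite c0 mulr0.
    - by rewrite -[x1]scale1r form_linr mul1r scale1r.
    - rewrite -[_ *: _]addr0 form_linr [form _ 0]big1 ?addr0 // => v _.
      by rewrite c0 mulr0.
  have [r ->] := spanned g; have [s ->] := spanned h.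
  have -> x y : (\sum_w r w *: x w) * y = \sum_w r w *: (x w * y) :> H.
    by rewrite mulr_suml; apply: eq_bigr => w _; rewrite scalerAl.
  have -> x y : y * (\sum_w r w *: x w) = \sum_w r w *: (y * x w) :> H.
    by rewrite mulr_sumr; apply: eq_bigr => w _; rewrite scalerAr.
  rewrite !form1_sum; apply: eq_bigr => u _; congr (_ * _).
  rewrite mulr_sumr mulr_suml.
  under eq_bigr => v _ do rewrite -scalerAr.
  under [in RHS]eq_bigr => v _ do rewrite -scalerAl.
  rewrite !form1_sum; apply: eq_bigr => v _; congr (_ * _).
  have form1 x y : form 1 (hecke_T T x * hecke_T T y) = (x^-1%g == y)%:R.
    by rewrite -form_T form_hecke_T invgK.
  by rewrite !form1 -(inj_eq invg_inj) invgK eq_sym.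
exists form; split=> //.
- move=> form' form'_coord g h.
  have [r ->] := spanned g; have [s ->] := spanned h.
  by rewrite form'_coord form_coord.
- split=> //.
  + split=> [h a x y|h a x y]; last exact: form_linr.
    by rewrite ![form _ h]formC form_linr.
  + move=> h x; rewrite rmorph_sum horner_sum; apply: sumr_ge0 => w _.
    by rewrite rmorphM hornerM -expr2 sqr_ge0.
  + move=> h /sum_sqr_poly_eq0 c_h; have [r def_h] := spanned h.
    rewrite def_h big1 // => w _.
    by rewrite -(c_sum r w) -def_h c_h scale0r.
(* Both sides become [form 1] of a product of the same four factors, and differ by moving [T_u] from
   the front to the back. *)
- move=> u v w; rewrite -mulrA !form_mul [LHS]form_hecke_T [RHS]form_hecke_T.
  by rewrite invgK form_trace !mulrA.
Qed.
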